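(* Let $d>0$ be an integer and let $\mathcal{E}$ be an exact category with enough projectives. Assume that $\dim_{\mathcal{GP}(\mathcal{E})}E<\infty$ for all $E\in\mathcal{E}$. Let $\mathcal{M}$ be a $d\mathbb{Z}$-cluster tilting subcategory of $\mathcal{E}$. Then $\mathcal{M}\cap\mathcal{GP}(\mathcal{E})$ is a $d\mathbb{Z}$-cluster tilting subcategory of $\mathcal{GP}(\mathcal{E})$.
   Context: Exact categories are in the sense of Quillen (conventions of Bühler). Let $\mathcal{P}$ be the full subcategory of projective objects of $\mathcal{E}$, and $\underline{\mathcal{E}}=\mathcal{E}/\mathcal{P}$ the stable category (same objects, written $\underline{E}$; morphisms modulo those factoring through projectives). The syzygy functor $\Omega\colon\underline{\mathcal{E}}\to\underline{\mathcal{E}}$ sends $\underline{E}$ to $\underline{\operatorname{Ker}p_E}$ for a chosen admissible epimorphism $p_E\colon P_E\to E$ with $P_E$ projective. A long exact sequence $P^\bullet=\cdots\to P^0\to P^1\to\cdots$ of projectives is totally acyclic if $\operatorname{Hom}_{\mathcal{E}}(P^\bullet,Q)$ is acyclic for all $Q\in\mathcal{P}$. An object $G\in\mathcal{E}$ is Gorenstein projective if $G=\operatorname{Ker}(P^0\to P^1)$ for some totally acyclic $P^\bullet$. $\mathcal{GP}(\mathcal{E})$ is the full subcategory of Gorenstein projective objects; it is extension closed in $\mathcal{E}$ and is regarded as an exact category whose exact sequences are those of $\mathcal{E}$ with all terms in $\mathcal{GP}(\mathcal{E})$. $\underline{\mathcal{GP}}(\mathcal{E})$ is its image in $\underline{\mathcal{E}}$.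 The Gorenstein projective dimension $\dim_{\mathcal{GP}(\mathcal{E})}E$ is the smallest integer $n\ge 0$ such that $\Omega^n(\underline{E})\in\underline{\mathcal{GP}}(\mathcal{E})$, and $\infty$ if there is none. Cluster tilting: a full subcategory $\mathcal{N}$ of an exact category $\mathcal{A}$ is $d$-cluster tilting if (1) $\mathcal{N}$ is functorially finite in $\mathcal{A}$, i.e. for each $A\in\mathcal{A}$ there is a morphism $N\to A$ with $N\in\mathcal{N}$ such that $\operatorname{Hom}(N',N)\to\operatorname{Hom}(N',A)$ is surjective for all $N'\in\mathcal{N}$, and a morphism $A\to N$ with $N\in\mathcal{N}$ such that $\operatorname{Hom}(N,N')\to\operatorname{Hom}(A,N')$ is surjective for all $N'\in\mathcal{N}$; (2) $\mathcal{N}=\{A\mid \operatorname{Ext}^i_{\mathcal{A}}(A,\mathcal{N})=0,\ 1\le i\le d-1\}=\{A\mid \operatorname{Ext}^i_{\mathcal{A}}(\mathcal{N},A)=0,\ 1\le i\le d-1\}$; (3) for every $A\in\mathcal{A}$ there are an admissible monomorphism $A\to N$ and an admissible epimorphism $N'\to A$ with $N,N'\in\mathcal{N}$. It is $d\mathbb{Z}$-cluster tilting if moreover $\operatorname{Ext}^i_{\mathcal{A}}(\mathcal{N},\mathcal{N})=0$ for all $i\notin d\mathbb{Z}$. *)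

(* Defs.v *)
From Stdlib Require Import Relations.
From mathcomp Require Import all_boot all_order all_algebra.

Set Implicit Arguments.
Unset Strict Implicit.
Unset Printing Implicit Defensive.

Import GRing.Theory.
Local Open Scope ring_scope.

Declare Scope cat_scope.
Delimit Scope cat_scope with cat.
Open Scope cat_scope.

Record preadditive := Preadditive {
  obj :> Type;
  hom : obj -> obj -> zmodType;
  idm : forall X, hom X X;
  comp : forall X Y Z, hom Y Z -> hom X Y -> hom X Z;
  compA : forall X Y Z T (h : hom Z T) (g : hom Y Z) (f : hom X Y),
    comp h (comp g f) = comp (comp h g) f;
  compIm : forall X Y (f : hom X Y), comp (idm Y) f = f;
  compmI : forall X Y (f : hom X Y), comp f (idm X) = f;
  compDl : forall X Y Z (g g' : hom Y Z) (f : hom X Y),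
    comp (g + g') f = comp g f + comp g' f;
  compDr : forall X Y Z (g : hom Y Z) (f f' : hom X Y),
    comp g (f + f') = comp g f + comp g f'
}.

Arguments idm {p} X.
Notation "g ∘ f" := (comp g f) (at level 40, left associativity) : cat_scope.

Section Preadditive.
Variable C : preadditive.

Definition is_iso (X Y : C) (f : hom X Y) : Prop :=
  exists g : hom Y X, g ∘ f = idm X /\ f ∘ g = idm Y.

Definition is_zero_object (Z : C) : Prop :=
  forall X : C, (forall f : hom X Z, f = 0) /\ (forall f : hom Z X, f = 0).

Definition is_biproduct (X Y S : C) (i1 : hom X S) (i2 : hom Y S)
    (p1 : hom S X) (p2 : hom S Y) : Prop :=
  [/\ p1 ∘ i1 = idm X, p2 ∘ i2 = idm Y, p1 ∘ i2 = 0, p2 ∘ i1 = 0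
    & i1 ∘ p1 + i2 ∘ p2 = idm S].

Definition is_additive : Prop :=
  (exists Z : C, is_zero_object Z) /\
  (forall X Y : C, exists (S : C) (i1 : hom X S) (i2 : hom Y S)
     (p1 : hom S X) (p2 : hom S Y), is_biproduct i1 i2 p1 p2).

Definition is_kernel (X Y Z : C) (i : hom X Y) (p : hom Y Z) : Prop :=
  p ∘ i = 0 /\
  forall (T : C) (f : hom T Y), p ∘ f = 0 -> exists! g : hom T X, i ∘ g = f.

Definition is_cokernel (X Y Z : C) (i : hom X Y) (p : hom Y Z) : Prop :=
  p ∘ i = 0 /\
  forall (T : C) (f : hom Y T), f ∘ i = 0 -> exists! g : hom Z T, g ∘ p = f.

Definition is_pushout (X Y X' Y' : C) (i : hom X Y) (f : hom X X')
    (f' : hom Y Y') (i' : hom X' Y') : Prop :=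
  f' ∘ i = i' ∘ f /\
  forall (T : C) (u : hom Y T) (v : hom X' T), u ∘ i = v ∘ f ->
    exists! w : hom Y' T, w ∘ f' = u /\ w ∘ i' = v.

Definition is_pullback (X Y X' Y' : C) (f' : hom X' X) (p' : hom X' Y')
    (p : hom X Y) (f : hom Y' Y) : Prop :=
  p ∘ f' = f ∘ p' /\
  forall (T : C) (u : hom T X) (v : hom T Y'), p ∘ u = f ∘ v ->
    exists! w : hom T X', f' ∘ w = u /\ p' ∘ w = v.

End Preadditive.

(* A preadditive category with a distinguished class of composable pairs; the
   axioms of an exact category are the separate predicate [is_exact].  The
   notions below only use the data, so they make sense at once for a full
   subcategory with the induced class of pairs. *)
Record conflation_category := ConflationCategory {
  underlying :> preadditive;
  conflation : forall X Y Z : underlying, hom X Y -> hom Y Z -> Prop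
}.

Section ConflationCategory.
Variable E : conflation_category.

Definition admissible_mono (X Y : E) (i : hom X Y) : Prop :=
  exists (Z : E) (p : hom Y Z), conflation i p.

Definition admissible_epi (Y Z : E) (p : hom Y Z) : Prop :=
  exists (X : E) (i : hom X Y), conflation i p.

(* Quillen's axioms as in Bühler, "Exact categories", Definition 2.1. *)
Record is_exact : Prop := IsExact {
  exact_additive : is_additive E;
  exact_kernel : forall (X Y Z : E) (i : hom X Y) (p : hom Y Z),
    conflation i p -> is_kernel i p;
  exact_cokernel : forall (X Y Z : E) (i : hom X Y) (p : hom Y Z),
    conflation i p -> is_cokernel i p;
  exact_iso : forall (X Y Z X' Y' Z' : E) (i : hom X Y) (p : hom Y Z)
      (i' : hom X' Y') (p' : hom Y' Z')
      (a : hom X X') (b : hom Y Y') (c : hom Z Z'),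
    is_iso a -> is_iso b -> is_iso c ->
    b ∘ i = i' ∘ a -> c ∘ p = p' ∘ b -> conflation i p -> conflation i' p';
  exact_id_mono : forall X : E, admissible_mono (idm X);
  exact_id_epi : forall X : E, admissible_epi (idm X);
  exact_comp_mono : forall (X Y Z : E) (i : hom X Y) (j : hom Y Z),
    admissible_mono i -> admissible_mono j -> admissible_mono (j ∘ i);
  exact_comp_epi : forall (X Y Z : E) (p : hom X Y) (q : hom Y Z),
    admissible_epi p -> admissible_epi q -> admissible_epi (q ∘ p);
  exact_pushout : forall (X Y X' : E) (i : hom X Y) (f : hom X X'),
    admissible_mono i ->
    exists (Y' : E) (f' : hom Y Y') (i' : hom X' Y'),
      is_pushout i f f' i' /\ admissible_mono i';
  exact_pullback : forall (X Y Y' : E) (p : hom X Y) (f : hom Y' Y),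
    admissible_epi p ->
    exists (X' : E) (f' : hom X' X) (p' : hom X' Y'),
      is_pullback f' p' p f /\ admissible_epi p'
}.

Definition projective (P : E) : Prop :=
  forall (X Y : E) (p : hom X Y) (f : hom P Y), admissible_epi p ->
    exists g : hom P X, p ∘ g = f.

Definition enough_projectives : Prop :=
  forall X : E, exists (P : E) (p : hom P X), projective P /\ admissible_epi p.

Record projective_presentation (X : E) := ProjectivePresentation {
  pres_ker : E;
  pres_proj : E;
  pres_inc : hom pres_ker pres_proj;
  pres_epi : hom pres_proj X;
  pres_projective : projective pres_proj;
  pres_conflation : conflation pres_inc pres_epi
}.

Definition syzygy (pres : forall X : E, projective_presentation X) (X : E) : E :=
  pres_ker (pres X).

(* The stable category has the objects of [E] and the morphisms of [E] modulo
   [stable_eq]; [stable_iso] is isomorphism there. *)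
Definition stable_eq (X Y : E) (f g : hom X Y) : Prop :=
  exists (P : E) (u : hom X P) (v : hom P Y), projective P /\ v ∘ u = f - g.

Definition stable_iso (X Y : E) : Prop :=
  exists (f : hom X Y) (g : hom Y X),
    stable_eq (g ∘ f) (idm X) /\ stable_eq (f ∘ g) (idm Y).

(* Cohomological indexing; [Z i] is the i-th cycle object. *)
Definition acyclic (P : int -> E) (d : forall i, hom (P i) (P (i + 1))) : Prop :=
  exists (Z : int -> E) (k : forall i, hom (Z i) (P i))
    (q : forall i, hom (P i) (Z (i + 1))),
    forall i, conflation (k i) (q i) /\ d i = k (i + 1) ∘ q i.

(* The last clause is exactness of Hom(P, Q) at Hom(P^(i+1), Q). *)
Definition totally_acyclic (P : int -> E)
    (d : forall i, hom (P i) (P (i + 1))) : Prop :=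
  [/\ forall i, projective (P i), acyclic d
    & forall Q : E, projective Q ->
      forall i (f : hom (P (i + 1)) Q), f ∘ d i = 0 ->
      exists g : hom (P (i + 1 + 1)) Q, f = g ∘ d (i + 1)].

Definition gorenstein_projective (G : E) : Prop :=
  exists (P : int -> E) (d : forall i, hom (P i) (P (i + 1)))
    (k : hom G (P 0)), totally_acyclic d /\ is_kernel k (d 0).

(* [X] lies in the (isomorphism-closed) image of the Gorenstein projective
   objects in the stable category. *)
Definition in_stable_GP (X : E) : Prop :=
  exists G : E, gorenstein_projective G /\ stable_iso X G.

Definition GP_dim_eq (pres : forall X : E, projective_presentation X)
    (X : E) (n : nat) : Prop :=
  in_stable_GP (iter n (syzygy pres) X) /\
  forall m : nat, in_stable_GP (iter m (syzygy pres) X) -> (n <= m)%N.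

Definition GP_dim_finite (pres : forall X : E, projective_presentation X)
    (X : E) : Prop :=
  exists n : nat, GP_dim_eq pres X n.

Record ses (K A : E) := Ses {
  ses_mid : E;
  ses_inf : hom K ses_mid;
  ses_def : hom ses_mid A;
  ses_conflation : conflation ses_inf ses_def
}.

(* [yext n A B] is the type of exact sequences
     0 -> B -> X_n -> ... -> X_1 -> A -> 0
   presented as spliced conflations, and is Hom(A, B) for n = 0. *)
Fixpoint yext (n : nat) (A B : E) : Type :=
  match n with
  | 0 => hom A B
  | m.+1 =>
    match m with
    | 0 => ses B A
    | _.+1 => {K : E & (ses K A * yext m K B)%type}
    end
  end.

Definition ses_mor (K K' A A' : E) (k : hom K K') (a : hom A A')
    (s : ses K A) (s' : ses K' A') : Prop :=
  exists x : hom (ses_mid s) (ses_mid s'),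
    x ∘ ses_inf s = ses_inf s' ∘ k /\ ses_def s' ∘ x = a ∘ ses_def s.

(* Existence of a morphism of sequences with prescribed maps [a], [b] at the
   ends. *)
Fixpoint yext_mor (n : nat) : forall (A A' B B' : E),
    hom A A' -> hom B B' -> yext n A B -> yext n A' B' -> Prop :=
  match n return forall (A A' B B' : E),
    hom A A' -> hom B B' -> yext n A B -> yext n A' B' -> Prop with
  | 0 => fun A A' B B' a b f f' => b ∘ (f : hom A B) = (f' : hom A' B') ∘ a
  | m.+1 =>
    match m return
      (forall A A' B B' : E,
         hom A A' -> hom B B' -> yext m A B -> yext m A' B' -> Prop) ->
      forall A A' B B' : E,
        hom A A' -> hom B B' -> yext m.+1 A B -> yext m.+1 A' B' -> Prop
    with
    | 0 => fun _ A A' B B' a b s s' => ses_mor b a s s'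
    | _.+1 => fun rec A A' B B' a b e e' =>
      exists k : hom (projT1 e) (projT1 e'),
        ses_mor k a (projT2 e).1 (projT2 e').1 /\
        rec _ _ _ _ k b (projT2 e).2 (projT2 e').2
    end (@yext_mor m)
  end.

Definition yext_equiv (n : nat) (A B : E) : yext n A B -> yext n A B -> Prop :=
  clos_refl_sym_trans _ (@yext_mor n A A B B (idm A) (idm B)).

(* Ext^n(A, B) is the quotient of [yext n A B] by [yext_equiv]; it is a group,
   so it vanishes iff all its elements are equal. *)
Definition Ext_eq0 (n : nat) (A B : E) : Prop :=
  forall e e' : yext n A B, yext_equiv e e'.

(* A full subcategory is given by a predicate on objects. *)

Definition functorially_finite (N : E -> Prop) : Prop :=
  forall A : E,
    (exists (X : E) (a : hom X A), N X /\
       forall (X' : E) (f : hom X' A), N X' -> exists g : hom X' X, a ∘ g = f) /\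
    (exists (X : E) (a : hom A X), N X /\
       forall (X' : E) (f : hom A X'), N X' -> exists g : hom X X', g ∘ a = f).

Record cluster_tilting (d : nat) (N : E -> Prop) : Prop := ClusterTilting {
  ct_functorially_finite : functorially_finite N;
  ct_left : forall A : E,
    N A <-> (forall X : E, N X -> forall i, (0 < i < d)%N -> Ext_eq0 i A X);
  ct_right : forall A : E,
    N A <-> (forall X : E, N X -> forall i, (0 < i < d)%N -> Ext_eq0 i X A);
  ct_cogenerating : forall A : E,
    exists (X : E) (i : hom A X), N X /\ admissible_mono i;
  ct_generating : forall A : E,
    exists (X : E) (p : hom X A), N X /\ admissible_epi p
}.

(* Ext vanishes in negative degrees, so only natural [i] need be considered. *)
Definition dZ_cluster_tilting (d : nat) (N : E -> Prop) : Prop :=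
  cluster_tilting d N /\
  forall X Y : E, N X -> N Y -> forall i : nat, ~~ (d %| i)%N -> Ext_eq0 i X Y.

End ConflationCategory.

Definition full_sub_preadditive (C : preadditive) (S : C -> Prop) : preadditive :=
  @Preadditive {X : C | S X}
    (fun X Y => hom (sval X) (sval Y))
    (fun X => idm (sval X))
    (fun X Y Z g f => g ∘ f)
    (fun X Y Z T h g f => compA h g f)
    (fun X Y f => compIm f)
    (fun X Y f => compmI f)
    (fun X Y Z g g' f => compDl g g' f)
    (fun X Y Z g f f' => compDr g f f').

(* The conflations are those of [E] with all three terms in [S], and morphisms
   are those of [E], so Ext in [full_sub S] uses middle terms in [S] only. *)
Definition full_sub (E : conflation_category) (S : E -> Prop) :
    conflation_category :=
  @ConflationCategory (full_sub_preadditive S)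
    (fun X Y Z (i : hom (sval X) (sval Y)) (p : hom (sval Y) (sval Z)) =>
       conflation i p).

Definition GP (E : conflation_category) : conflation_category :=
  full_sub (@gorenstein_projective E).

Definition restrict_to_GP (E : conflation_category) (M : E -> Prop) :
    GP E -> Prop :=
  fun G => M (sval G).

(* Main.v *)
From Stdlib Require Import Relations ClassicalEpsilon.
From mathcomp Require Import all_boot all_order all_algebra zify.
Require Import Defs.

Set Implicit Arguments.
Unset Strict Implicit.
Unset Printing Implicit Defensive.

Import GRing.Theory.
Local Open Scope ring_scope.

(** Write [Omega] for the syzygy and think of [Ext^i(A, B)], [i > 0], as the maps
    from [Omega^i A] to [B] modulo those that extend to the projective containing
    [Omega^i A] ([Ext_eq0P]).  This applies to the exact category [E] and also to
    its Gorenstein projective objects: they are closed under extensions and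
    syzygies, so the projective presentations of [E] serve there too, and Ext
    between Gorenstein projectives is the same in both categories
    ([GP_Ext_eq0]).  The rigidity of [M /\ GP], in all degrees outside [dZ], is
    thus inherited from [M], and projectives give the generating and
    cogenerating conditions.

    The main point is that every [X] in [M] has a map [h : H -> X] with [H] in
    [M /\ GP] such that, up to maps through projectives, every map from a
    Gorenstein projective to [X] factors through [h]
    ([tilting_stable_cover]).  Indeed [Omega^d] preserves [M], since
    [Ext^i(Omega^d X, Y) = Ext^(i+d)(X, Y)].  As [X] has finite Gorenstein
    projective dimension, [Omega^(nd) X] is stably isomorphic to some Gorenstein
    projective [B] for [n] large, and [B] lies in [M].  On Gorenstein projectives
    [Omega] can be undone, and [H] is [Omega^(-nd) B]: a map [f : G -> X] induces
    [Omega^(nd) G -> B], and applying [Omega^(-nd)] gives [G -> H].  That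
    [Omega^(-d)] preserves [M /\ GP] comes from
    [Ext^i(Omega^(-d) G, Y) = Ext^i(G, Omega^d Y)] for all [Y] in [E]
    ([cosyzygy_ext], [tilting_cosyzygy]).

    Composing approximations in [E] by objects of [M] with these maps shows that
    [M /\ GP] is functorially finite.  If [A] is Gorenstein projective and
    [Ext^i(A, N) = 0] for [N] in [M /\ GP] and [0 < i < d], then
    [Ext^i(A, X) = 0] for every [X] in [M], because it is a quotient of
    [Ext^i(A, H)]; so [A] is in [M] ([gproj_tilting_left]).  If instead
    [Ext^i(N, A) = 0], coresolve [A] by left approximations, which can be chosen
    to be admissible monomorphisms with Gorenstein projective cokernel.  The
    [(d-1)]-st cokernel satisfies the previous criterion, and the conflations
    split one after the other back to [A] ([gproj_tilting_right]). *)

(** * Preadditive and exact categories *)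

Section PreadditiveTheory.
Variable C : preadditive.

Lemma comp0l (X Y Z : C) (f : hom X Y) : (0 : hom Y Z) ∘ f = 0.
Proof. by apply: (addrI ((0 : hom Y Z) ∘ f)); rewrite -compDl !addr0. Qed.

Lemma comp0r (X Y Z : C) (g : hom Y Z) : g ∘ (0 : hom X Y) = 0.
Proof. by apply: (addrI (g ∘ (0 : hom X Y))); rewrite -compDr !addr0. Qed.

Lemma compNl (X Y Z : C) (g : hom Y Z) (f : hom X Y) : (- g) ∘ f = - (g ∘ f).
Proof. by apply: (addrI (g ∘ f)); rewrite -compDl !subrr comp0l. Qed.

Lemma compNr (X Y Z : C) (g : hom Y Z) (f : hom X Y) : g ∘ (- f) = - (g ∘ f).
Proof. by apply: (addrI (g ∘ f)); rewrite -compDr !subrr comp0r. Qed.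

Lemma compBl (X Y Z : C) (g g' : hom Y Z) (f : hom X Y) :
  (g - g') ∘ f = g ∘ f - g' ∘ f.
Proof. by rewrite compDl compNl. Qed.

Lemma compBr (X Y Z : C) (g : hom Y Z) (f f' : hom X Y) :
  g ∘ (f - f') = g ∘ f - g ∘ f'.
Proof. by rewrite compDr compNr. Qed.

Lemma is_iso_id (X : C) : is_iso (idm X).
Proof. by exists (idm X); rewrite compIm. Qed.

Lemma kernel_lift (X Y Z T : C) (i : hom X Y) (p : hom Y Z) (f : hom T Y) :
  is_kernel i p -> p ∘ f = 0 -> exists g, i ∘ g = f.
Proof. by move=> [_ H] /H [g [? _]]; exists g. Qed.

Lemma kernel_mono (X Y Z T : C) (i : hom X Y) (p : hom Y Z) (g g' : hom T X) :
  is_kernel i p -> i ∘ g = i ∘ g' -> g = g'.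
Proof.
move=> [pi H] e; have [|h [_ u]] := H _ (i ∘ g); first by rewrite compA pi comp0l.
by rewrite -(u g) // -(u g').
Qed.

Lemma cokernel_lift (X Y Z T : C) (i : hom X Y) (p : hom Y Z) (f : hom Y T) :
  is_cokernel i p -> f ∘ i = 0 -> exists g, g ∘ p = f.
Proof. by move=> [_ H] /H [g [? _]]; exists g. Qed.

Lemma cokernel_epi (X Y Z T : C) (i : hom X Y) (p : hom Y Z) (g g' : hom Z T) :
  is_cokernel i p -> g ∘ p = g' ∘ p -> g = g'.
Proof.
move=> [pi H] e; have [|h [_ u]] := H _ (g ∘ p); first by rewrite -compA pi comp0r.
by rewrite -(u g) // -(u g').
Qed.

Lemma pushout_map (X Y X' Y' T : C) (i : hom X Y) (f : hom X X')
    (f' : hom Y Y') (i' : hom X' Y') (u : hom Y T) (v : hom X' T) :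
  is_pushout i f f' i' -> u ∘ i = v ∘ f -> exists w, w ∘ f' = u /\ w ∘ i' = v.
Proof. by move=> [_ H] /H [w [? _]]; exists w. Qed.

Lemma pushout_eq (X Y X' Y' T : C) (i : hom X Y) (f : hom X X')
    (f' : hom Y Y') (i' : hom X' Y') (w w' : hom Y' T) :
  is_pushout i f f' i' -> w ∘ f' = w' ∘ f' -> w ∘ i' = w' ∘ i' -> w = w'.
Proof.
move=> [c H] e1 e2; have [|h [_ u]] := H _ (w ∘ f') (w ∘ i').
  by rewrite -!compA c.
by rewrite -(u w) // -(u w').
Qed.

Lemma pullback_map (X Y X' Y' T : C) (f' : hom X' X) (p' : hom X' Y')
    (p : hom X Y) (f : hom Y' Y) (u : hom T X) (v : hom T Y') :
  is_pullback f' p' p f -> p ∘ u = f ∘ v -> exists w, f' ∘ w = u /\ p' ∘ w = v.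
Proof. by move=> [_ H] /H [w [? _]]; exists w. Qed.

Lemma pullback_eq (X Y X' Y' T : C) (f' : hom X' X) (p' : hom X' Y')
    (p : hom X Y) (f : hom Y' Y) (w w' : hom T X') :
  is_pullback f' p' p f -> f' ∘ w = f' ∘ w' -> p' ∘ w = p' ∘ w' -> w = w'.
Proof.
move=> [c H] e1 e2; have [|h [_ u]] := H _ (f' ∘ w) (p' ∘ w).
  by rewrite !compA c.
by rewrite -(u w) // -(u w').
Qed.

End PreadditiveTheory.

(** The part of the exact structure that the Yoneda description of Ext uses.
    Unlike exactness itself, it passes to an extension closed full subcategory
    by inspection. *)
Record conflations_push (C : conflation_category) : Prop := ConflationsPush {
  push_kernel : forall (X Y Z : C) (i : hom X Y) (p : hom Y Z),
    conflation i p -> is_kernel i p;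
  push_cokernel : forall (X Y Z : C) (i : hom X Y) (p : hom Y Z),
    conflation i p -> is_cokernel i p;
  push_conflation : forall (X Y Z X' : C) (i : hom X Y) (p : hom Y Z)
      (f : hom X X'), conflation i p ->
    exists (Y' : C) (f' : hom Y Y') (i' : hom X' Y') (p' : hom Y' Z),
      [/\ is_pushout i f f' i', conflation i' p' & p' ∘ f' = p]
}.

Section ExactTheory.
Variables (E : conflation_category) (hE : is_exact E).

Lemma conflation_cokernel (X Y Z Z' : E) (i : hom X Y) (p : hom Y Z)
    (p' : hom Y Z') : conflation i p -> is_cokernel i p' -> conflation i p'.
Proof.
move=> c k'; have k := exact_cokernel hE c.
have [a ea] := cokernel_lift k k'.1; have [b eb] := cokernel_lift k' k.1.
apply: (exact_iso hE (a := idm X) (b := idm Y) (c := a)) c; rewrite ?compIm ?compmI //.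
- exact: is_iso_id.
- exact: is_iso_id.
exists b; split; first by apply: (cokernel_epi k); rewrite compIm -compA ea.
by apply: (cokernel_epi k'); rewrite compIm -compA eb.
Qed.

Lemma conflation_kernel (X X' Y Z : E) (i : hom X Y) (i' : hom X' Y)
    (p : hom Y Z) : conflation i p -> is_kernel i' p -> conflation i' p.
Proof.
move=> c k'; have k := exact_kernel hE c.
have [a ea] := kernel_lift k' k.1; have [b eb] := kernel_lift k k'.1.
apply: (exact_iso hE (a := a) (b := idm Y) (c := idm Z)) c; rewrite ?compIm ?compmI //.
- exists b; split; first by apply: (kernel_mono k); rewrite compmI compA eb.
  by apply: (kernel_mono k'); rewrite compmI compA ea.
- exact: is_iso_id.
exact: is_iso_id.
Qed.

Lemma conflation_pushout (X Y Z X' : E) (i : hom X Y) (p : hom Y Z)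
    (f : hom X X') : conflation i p ->
  exists (Y' : E) (f' : hom Y Y') (i' : hom X' Y') (p' : hom Y' Z),
    [/\ is_pushout i f f' i', conflation i' p' & p' ∘ f' = p].
Proof.
move=> c; have k := exact_cokernel hE c.
have [Y' [f' [i' [po [W [q cq]]]]]] := exact_pushout hE f (ex_intro _ Z (ex_intro _ p c)).
have [|p' [e1 e2]] := pushout_map (u := p) (v := 0) po; first by rewrite k.1 comp0l.
exists Y', f', i', p'; split=> //; apply: conflation_cokernel cq _.
split=> // T g gi; have [|w ew] := cokernel_lift k (f := g ∘ f').
  by rewrite -compA po.1 compA gi comp0l.
exists w; split.
  by apply: (pushout_eq po); rewrite -compA ?e1 // e2 comp0r gi.
by move=> w' ew'; apply: (cokernel_epi k); rewrite ew -ew' -compA e1.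
Qed.

Lemma conflation_pullback (X Y Z Z' : E) (i : hom X Y) (p : hom Y Z)
    (f : hom Z' Z) : conflation i p ->
  exists (Y' : E) (f' : hom Y' Y) (i' : hom X Y') (p' : hom Y' Z'),
    [/\ is_pullback f' p' p f, conflation i' p' & f' ∘ i' = i].
Proof.
move=> c; have k := exact_kernel hE c.
have [Y' [f' [p' [pb [W [j cj]]]]]] := exact_pullback hE f (ex_intro _ X (ex_intro _ i c)).
have [|i' [e1 e2]] := pullback_map (u := i) (v := 0) pb; first by rewrite k.1 comp0r.
exists Y', f', i', p'; split=> //; apply: conflation_kernel cj _.
split=> // T g pg; have [|w ew] := kernel_lift k (f := f' ∘ g).
  by rewrite compA pb.1 -compA pg comp0r.
exists w; split.
  by apply: (pullback_eq pb); rewrite compA ?e1 // e2 comp0l pg.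
by move=> w' ew'; apply: (kernel_mono k); rewrite ew -ew' compA e1.
Qed.

Lemma exact_conflations_push : conflations_push E.
Proof.
split; [exact: exact_kernel hE | exact: exact_cokernel hE |].
by move=> X Y Z X' i p f; apply: conflation_pushout.
Qed.

End ExactTheory.

(** * Ext through projective presentations *)

(** Lifting [v] along [q] gives a correction of [b] after which it lands in the
    kernel [K'] of [q]; this is the null homotopy. *)
Lemma null_lift (C : conflation_category) (hC : conflations_push C)
    (K P X K' Y X' Q : C) (i : hom K P) (p : hom P X) (j : hom K' Y)
    (q : hom Y X') (k : hom K K') (b : hom P Y) (u : hom X Q) (v : hom Q X') :
  conflation i p -> conflation j q -> projective Q ->
  j ∘ k = b ∘ i -> q ∘ b = v ∘ u ∘ p -> exists w : hom P K', w ∘ i = k.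
Proof.
move=> c c' pQ e1 e2; have kq := push_kernel hC c'.
have [|v' ev] := pQ _ _ q v; first by exists K', j.
have [|w ew] := kernel_lift kq (f := b - v' ∘ u ∘ p).
  by rewrite compBr e2 !compA ev subrr.
exists w; apply: (kernel_mono kq); rewrite compA ew compBl -e1 -[_ ∘ i]compA.
by rewrite (push_cokernel hC c).1 comp0r subr0.
Qed.

Section Yoneda.
Variables (C : conflation_category) (hC : conflations_push C).
Variable pres : forall X : C, projective_presentation X.

Local Notation Omega := (syzygy pres).
Local Notation inc X := (pres_inc (pres X)).
Local Notation epi X := (pres_epi (pres X)).
Local Notation projP X := (@pres_projective _ _ (pres X)).

(** The vanishing of [Ext^(n+1)(A, B)], by dimension shifting.  Counting from
    [Ext^1] avoids [Ext^0], which is not a quotient of this form. *)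
Fixpoint ext_vanish (n : nat) (A B : C) : Prop :=
  match n with
  | 0 => forall f : hom (Omega A) B,
      exists g : hom (pres_proj (pres A)) B, g ∘ inc A = f
  | m.+1 => ext_vanish m (Omega A) B
  end.

(** Shifting at the inner end makes [syz n.+1 A] reduce to [syz n (Omega A)], as
    in [ext_vanish]. *)
Fixpoint syz (n : nat) (A : C) : C :=
  match n with 0 => A | m.+1 => syz m (Omega A) end.

Fixpoint extends (n : nat) (A B : C) : hom (syz n.+1 A) B -> Prop :=
  match n return hom (syz n.+1 A) B -> Prop with
  | 0 => fun f => exists g : hom (pres_proj (pres A)) B, g ∘ inc A = f
  | m.+1 => fun f => @extends m (Omega A) B f
  end.

Lemma ext_vanishE n A B :
  ext_vanish n A B <-> forall f : hom (syz n.+1 A) B, extends f.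
Proof. by elim: n A => [|n IH] A //=; apply: IH. Qed.

Definition pres_ses (A : C) : ses (Omega A) A := Ses (pres_conflation (pres A)).

Fixpoint resolution (n : nat) (A : C) : yext n.+1 A (syz n.+1 A) :=
  match n return yext n.+1 A (syz n.+1 A) with
  | 0 => pres_ses A
  | m.+1 => existT _ (Omega A) (pres_ses A, resolution m (Omega A))
  end.

Lemma pres_lift (A X Y : C) (p : hom X Y) (f : hom (pres_proj (pres A)) Y) :
  admissible_epi p -> exists g, p ∘ g = f.
Proof. exact: pres_projective. Qed.

Lemma resolution_lift n (A' A B : C) (a : hom A' A) (e : yext n.+1 A B) :
  exists f, yext_mor a f (resolution n A') e.
Proof.
have lift A1 A2 K (a1 : hom A1 A2) (s : ses K A2) :
    exists f, ses_mor f a1 (pres_ses A1) s.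
  have [|x ex] := pres_lift (p := ses_def s) (a1 ∘ epi A1).
    by exists K, (ses_inf s); apply: ses_conflation.
  have [|f ef] := kernel_lift (push_kernel hC (ses_conflation s)) (f := x ∘ inc A1).
    by rewrite compA ex -compA (push_cokernel hC (pres_conflation (pres A1))).1 comp0r.
  by exists f, x; split.
elim: n A' A a e => [|n IH] A' A a e; first exact: lift.
case: e => K [s e]; have [k hk] := lift _ _ _ a s.
by have [f hf] := IH _ _ k e; exists f, k.
Qed.

(** A chain map over a map that factors through a projective is null homotopic;
    the homotopy in one degree is the factorization used in the next. *)
Lemma resolution_unique n (A' A B Q : C) (a a' : hom A' A) (u : hom A' Q)
    (v : hom Q A) (e : yext n.+1 A B) (f f' : hom (syz n.+1 A') B) :
  projective Q -> v ∘ u = a - a' ->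
  yext_mor a f (resolution n A') e -> yext_mor a' f' (resolution n A') e ->
  extends (f - f').
Proof.
have key A1 A2 K Q1 (a1 a1' : hom A1 A2) (u1 : hom A1 Q1) (v1 : hom Q1 A2)
    (s : ses K A2) f1 f1' : projective Q1 -> v1 ∘ u1 = a1 - a1' ->
    ses_mor f1 a1 (pres_ses A1) s -> ses_mor f1' a1' (pres_ses A1) s ->
    exists w : hom (pres_proj (pres A1)) K, w ∘ inc A1 = f1 - f1'.
  move=> pQ vu [x [/= x1 x2]] [x' [/= x1' x2']].
  apply: (null_lift hC (b := x - x') (u := u1) (v := v1) (pres_conflation (pres A1))
    (ses_conflation s) pQ).
    by rewrite compBr compBl x1 x1'.
  by rewrite compBr x2 x2' vu compBl.
elim: n A' A Q a a' u v e f f' => [|n IH] A' A Q a a' u v e f f' pQ vu.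
  by apply: key pQ vu.
case: e => K [s e] [k [hk hf]] [k' [hk' hf']].
have [w ew] := key _ _ _ _ _ _ _ _ _ _ _ pQ vu hk hk'.
exact: (IH _ _ _ _ _ _ _ _ _ _ (projP A') ew hf hf').
Qed.

Lemma resolution_shift n (A' A B : C) (a : hom A' A) (e : yext n.+1 A B)
    (f f' : hom (syz n.+1 A') B) :
  yext_mor a f (resolution n A') e -> extends (f - f') ->
  yext_mor a f' (resolution n A') e.
Proof.
elim: n A' A a e f f' => [|n IH] A' A a e f f'.
  move=> [x [/= x1 x2]] [g eg]; exists (x - ses_inf e ∘ g) => /=.
  rewrite compBl compBr x1 x2 -compA eg compBr compA.
  rewrite (push_kernel hC (ses_conflation e)).1 comp0l subr0.
  by rewrite opprB addrCA subrr addr0.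
by case: e => K [s e] [k [hk hf]] ef; exists k; split=> //; apply: IH hf ef.
Qed.

Lemma yext_mor_comp n (A A' A'' B B' B'' : C) (a : hom A A') (a' : hom A' A'')
    (b : hom B B') (b' : hom B' B'') (e : yext n.+1 A B) (e' : yext n.+1 A' B')
    (e'' : yext n.+1 A'' B'') :
  yext_mor a b e e' -> yext_mor a' b' e' e'' -> yext_mor (a' ∘ a) (b' ∘ b) e e''.
Proof.
have key K K' K'' D D' D'' (k : hom K K') (k' : hom K' K'') (a1 : hom D D')
    (a1' : hom D' D'') (s : ses K D) (s' : ses K' D') (s'' : ses K'' D'') :
    ses_mor k a1 s s' -> ses_mor k' a1' s' s'' ->
    ses_mor (k' ∘ k) (a1' ∘ a1) s s''.
  move=> [x [x1 x2]] [y [y1 y2]]; exists (y ∘ x).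
  by split; [rewrite -compA x1 !compA y1 | rewrite compA y2 -!compA x2].
elim: n A A' A'' a a' e e' e'' => [|n IH] A A' A'' a a' e e' e''; first exact: key.
case: e e' e'' => K [s e] [K' [s' e']] [K'' [s'' e'']] [k [hk h]] [k' [hk' h']].
by exists (k' ∘ k); split; [apply: key hk hk' | apply: IH h h'].
Qed.

(** [ef] replaces the last conflation of the resolution by its pushout along
    [f]; the universal property of that pushout makes [ef] initial among the
    extensions that receive the resolution through [f]. *)
Lemma resolution_pushout n (A B : C) (f : hom (syz n.+1 A) B) :
  exists ef : yext n.+1 A B, yext_mor (idm A) f (resolution n A) ef /\
    forall A2 (a : hom A A2) (e : yext n.+1 A2 B),
      yext_mor a f (resolution n A) e -> yext_mor a (idm B) ef e.
Proof.
elim: n A f => [|n IH] A f.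
  have [Y' [f' [i' [p' [po c e]]]]] := push_conflation hC f (pres_conflation (pres A)).
  exists (Ses c); split; first by exists f'; rewrite /= compIm po.1.
  move=> A2 a s [x [/= x1 x2]]; have [y [y1 y2]] := pushout_map po x1.
  exists y; rewrite /= compmI; split=> //; apply: (pushout_eq po).
    by rewrite -compA y1 x2 -compA e.
  rewrite -!compA y2 (push_kernel hC c).1 comp0r.
  exact: (push_kernel hC (ses_conflation s)).1.
have [ef [h1 h2]] := IH (Omega A) f.
exists (existT _ (Omega A) (pres_ses A, ef)); split=> /=.
  exists (idm (Omega A)); split=> //.
  by exists (idm _); rewrite !compIm !compmI.
move=> A2 a [K [s e]] [k [hk hf]]; exists k; split=> //; exact: h2.
Qed.

(** The maps [f] whose pushout is [e] form a class modulo the maps that extend,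
    and this class is an invariant of the Yoneda class of [e]; by
    [resolution_pushout] it is a complete one, and every class occurs. *)
Lemma Ext_eq0P n (A B : C) : Ext_eq0 n.+1 A B <-> ext_vanish n A B.
Proof.
have inv (e e' : yext n.+1 A B) : yext_equiv e e' -> forall f,
    yext_mor (idm A) f (resolution n A) e <-> yext_mor (idm A) f (resolution n A) e'.
  elim=> {e e'} [e e' ee' | // | e e' _ IH | e1 e2 e3 _ IH1 _ IH2] f; last first.
  - by split=> [/IH1 /IH2 | /IH2 /IH1].
  - by split=> [/IH | /IH].
  have fwd g : yext_mor (idm A) g (resolution n A) e ->
      yext_mor (idm A) g (resolution n A) e'.
    by move=> /yext_mor_comp /(_ ee'); rewrite !compIm.
  split=> [/fwd // | hf]; have [g hg] := resolution_lift (idm A) e.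
  apply: (resolution_shift hg).
  apply: (resolution_unique (u := (0 : hom A (pres_proj (pres A)))) (v := epi A)
    (projP A)) (fwd _ hg) hf.
  by rewrite comp0r subrr.
split=> [h | /ext_vanishE h].
  apply/ext_vanishE => f.
  have [ef [hf _]] := resolution_pushout f.
  have [e0 [h0 _]] := resolution_pushout (0 : hom (syz n.+1 A) B).
  have /inv/(_ f) [hf' _] := h ef e0.
  rewrite -[f]subr0.
  apply: (resolution_unique (u := (0 : hom A (pres_proj (pres A)))) (v := epi A)
    (projP A)) (hf' hf) h0.
  by rewrite comp0r subrr.
move=> e e'; have [f hf] := resolution_lift (idm A) e.
have [f' hf'] := resolution_lift (idm A) e'.
have {}hf' := resolution_shift hf' (h (f' - f)).
have [ef [_ hef]] := resolution_pushout f.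
apply: (rst_trans _ _ _ ef); last by apply: rst_step; apply: hef.
by apply: rst_sym; apply: rst_step; apply: hef.
Qed.

Lemma Ext_eq0_range d A B :
  (forall i, (0 < i < d)%N -> Ext_eq0 i A B) <->
  (forall i, (i.+1 < d)%N -> ext_vanish i A B).
Proof.
split=> h i; first by move=> hi; apply/Ext_eq0P; apply: h.
by case: i => // i hi; apply/Ext_eq0P; apply: h.
Qed.

End Yoneda.

(** * Exact sequences for Ext *)

Section ExtTheory.
Variables (E : conflation_category) (hE : is_exact E).
Variable pres : forall X : E, projective_presentation X.

Local Notation Omega := (syzygy pres).
Local Notation inc X := (pres_inc (pres X)).
Local Notation epi X := (pres_epi (pres X)).
Local Notation projP X := (@pres_projective _ _ (pres X)).
Local Notation confP X := (pres_conflation (pres X)).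
Local Notation ext := (ext_vanish pres).

Let hC := exact_conflations_push hE.

Lemma conflation_comp0 (X Y Z : E) (i : hom X Y) (p : hom Y Z) :
  conflation i p -> p ∘ i = 0.
Proof. by move/(exact_kernel hE)=> []. Qed.

Lemma projective_lift (P X Y Z : E) (i : hom X Y) (p : hom Y Z) (f : hom P Z) :
  projective P -> conflation i p -> exists g, p ∘ g = f.
Proof. by move=> pP c; apply: pP; exists X, i. Qed.

Lemma projective_map (K P X K' Y X' : E) (i : hom K P) (p : hom P X)
    (j : hom K' Y) (q : hom Y X') (a : hom X X') :
  projective P -> conflation i p -> conflation j q ->
  exists b k, q ∘ b = a ∘ p /\ j ∘ k = b ∘ i.
Proof.
move=> pP c c'; have [b eb] := projective_lift (a ∘ p) pP c'.
have [|k ek] := kernel_lift (exact_kernel hE c') (f := b ∘ i); last by exists b, k.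
by rewrite compA eb -compA (conflation_comp0 c) comp0r.
Qed.

Lemma conflation_retraction (B Y Z : E) (i : hom B Y) (p : hom Y Z)
    (s : hom Z Y) : conflation i p -> p ∘ s = idm Z ->
  exists r, r ∘ i = idm B /\ i ∘ r + s ∘ p = idm Y.
Proof.
move=> c ps; have k := exact_kernel hE c.
have [|r er] := kernel_lift k (f := idm Y - s ∘ p).
  by rewrite compBr compmI compA ps compIm subrr.
exists r; rewrite er subrK; split=> //; apply: (kernel_mono k).
by rewrite compA er compBl compIm compmI -compA (conflation_comp0 c) comp0r subr0.
Qed.

Lemma ext0_section (B Y Z : E) (i : hom B Y) (p : hom Y Z) :
  conflation i p -> ext 0 Z B -> exists s, p ∘ s = idm Z.
Proof.
move=> c h; have [a [k [ea ek]]] := projective_map (idm Z) (projP Z) (confP Z) c.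
have [g eg] := h k; have cz := exact_cokernel hE (confP Z).
have [|s es] := cokernel_lift cz (f := a - i ∘ g).
  by rewrite compBl -ek -compA eg subrr.
exists s; apply: (cokernel_epi cz).
by rewrite -compA es compBr ea compA (conflation_comp0 c) comp0l subr0.
Qed.

(** The long exact sequence [Hom(Y, B) -> Hom(X, B) -> Ext^1(Z, B)]: the
    pushout of the conflation along [f] splits. *)
Lemma ext0_extend (X Y Z B : E) (i : hom X Y) (p : hom Y Z) (f : hom X B) :
  conflation i p -> ext 0 Z B -> exists g, g ∘ i = f.
Proof.
move=> c h; have [Y' [f' [i' [p' [po c' _]]]]] := conflation_pushout hE f c.
have [s es] := ext0_section c' h.
have [r [er _]] := conflation_retraction c' es.
by exists (r ∘ f'); rewrite -compA po.1 compA er compIm.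
Qed.

Definition stable_retract (B Z : E) : Prop :=
  exists (s : hom B Z) (r : hom Z B), stable_eq (r ∘ s) (idm B).

Lemma retract_stable_retract (B Z : E) (s : hom B Z) (r : hom Z B) :
  r ∘ s = idm B -> stable_retract B Z.
Proof.
move=> e; exists s, r, (pres_proj (pres B)), 0, (epi B).
by rewrite e comp0r subrr; split=> //; exact: (projP B).
Qed.

Lemma stable_retract_refl (B : E) : stable_retract B B.
Proof. by apply: (@retract_stable_retract B B (idm B) (idm B)); rewrite compIm. Qed.

Lemma stable_iso_retract (X Y : E) :
  stable_iso X Y -> stable_retract X Y /\ stable_retract Y X.
Proof. by move=> [f [g [h1 h2]]]; split; [exists f, g | exists g, f]. Qed.

(** Lifting a stable retraction to syzygies leaves an error that factors through
    the inclusion of the syzygy in its projective. *)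
Lemma stable_retract_lift (K P X K' P' X' : E) (i : hom K P) (p : hom P X)
    (i' : hom K' P') (p' : hom P' X') :
  conflation i p -> projective P -> conflation i' p' -> projective P' ->
  stable_retract X X' ->
  exists (s : hom K K') (r : hom K' K) (b : hom P P') (w : hom P K),
    i' ∘ s = b ∘ i /\ w ∘ i = r ∘ s - idm K.
Proof.
move=> c pP c' pP' [s [r [Q [u [v [pQ vu]]]]]].
have [b [k [eb ek]]] := projective_map s pP c c'.
have [b' [k' [eb' ek']]] := projective_map r pP' c' c.
have [|| w ew] := null_lift hC (k := k' ∘ k - idm K) (b := b' ∘ b - idm P) (u := u) (v := v) c c pQ.
- by rewrite compBr compBl compmI compIm compA ek' -!compA ek.
- by rewrite compBr compmI compA eb' -compA eb vu compBl compIm compA.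
by exists k, k', b, w.
Qed.

Lemma stable_retract_syzygy (K P X K' P' X' : E) (i : hom K P) (p : hom P X)
    (i' : hom K' P') (p' : hom P' X') :
  conflation i p -> projective P -> conflation i' p' -> projective P' ->
  stable_retract X X' -> stable_retract K K'.
Proof.
move=> c pP c' pP' h.
have [s [r [b [w [_ ew]]]]] := stable_retract_lift c pP c' pP' h.
by exists s, r, P, i, w.
Qed.

Lemma extend_retract (K P X K' P' X' B : E) (i : hom K P) (p : hom P X)
    (i' : hom K' P') (p' : hom P' X') :
  conflation i p -> projective P -> conflation i' p' -> projective P' ->
  stable_retract X X' ->
  (forall f : hom K' B, exists g, g ∘ i' = f) ->
  forall f : hom K B, exists g, g ∘ i = f.
Proof.
move=> c pP c' pP' h hf f.
have [s [r [b [w [es ew]]]]] := stable_retract_lift c pP c' pP' h.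
have [g eg] := hf (f ∘ r); exists (g ∘ b - f ∘ w).
rewrite compBl -!compA -es ew compBr compmI !compA eg.
by rewrite opprB addrCA subrr addr0.
Qed.

Lemma ext_retract n (X Y B : E) : stable_retract X Y -> ext n Y B -> ext n X B.
Proof.
elim: n X Y => [|n IH] X Y h.
  exact: (extend_retract (confP X) (projP X) (confP Y) (projP Y)).
by apply: IH; apply: stable_retract_syzygy (confP X) (projP X) (confP Y) (projP Y) h.
Qed.

Lemma ext0_presentation (K P X B : E) (i : hom K P) (p : hom P X) :
  conflation i p -> projective P ->
  (forall f : hom K B, exists g, g ∘ i = f) -> ext 0 X B.
Proof.
move=> c pP.
exact: (extend_retract (confP X) (projP X) c pP (stable_retract_refl X)).
Qed.

Lemma syzygy_stable_retract (K P X : E) (i : hom K P) (p : hom P X) :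
  conflation i p -> projective P ->
  stable_retract K (Omega X) /\ stable_retract (Omega X) K.
Proof.
move=> c pP; have h := stable_retract_refl X; split.
  exact: stable_retract_syzygy c pP (confP X) (projP X) h.
exact: stable_retract_syzygy (confP X) (projP X) c pP h.
Qed.

(** The triangle [X -> Y -> Z] rotated backwards: in the pullback of [P -> Z]
    along [p] the projective [P] splits off, leaving [X]. *)
Lemma conflation_rotate (X Y Z K P : E) (i : hom X Y) (p : hom Y Z)
    (k : hom K P) (q : hom P Z) (g : hom P Y) (m : hom K X) :
  conflation i p -> conflation k q -> projective P ->
  p ∘ g = q -> i ∘ m = g ∘ k ->
  exists (T : E) (t : hom K T) (u : hom T Y) (s : hom X T) (r : hom T X),
    [/\ conflation t u, r ∘ s = idm X, stable_eq (s ∘ r) (idm T) & r ∘ t = - m].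
Proof.
move=> c c0 pP pg im; have ki := exact_kernel hE c.
have [T [f [t [u [pb c1 ft]]]]] := conflation_pullback hE p c0.
have [|s [s1 s2]] := pullback_map (u := 0) (v := i) pb.
  by rewrite comp0r (conflation_comp0 c).
have [|x [x1 x2]] := pullback_map (u := idm P) (v := g) pb; first by rewrite compmI pg.
have [|r er] := kernel_lift ki (f := u - g ∘ f).
  by rewrite compBr compA pg pb.1 subrr.
have er1 : s ∘ r = idm T - x ∘ f.
  apply: (pullback_eq pb).
    by rewrite compA s1 comp0l compBr compmI compA x1 compIm subrr.
  by rewrite compA s2 er compBr compmI compA x2.
exists T, t, u, s, r; split=> //.
- apply: (kernel_mono ki); rewrite compA er compBl s2 -compA s1.
  by rewrite comp0r subr0 compmI.
- exists P, f, (- x); split=> //.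
  by rewrite er1 compNl addrAC subrr add0r.
apply: (kernel_mono ki); rewrite compA er compBl (conflation_comp0 c1) sub0r.
by rewrite -compA ft compNr im.
Qed.

Lemma conflation_rotate_syzygy (X Y Z : E) (i : hom X Y) (p : hom Y Z) :
  conflation i p ->
  exists (T : E) (t : hom (Omega Z) T) (u : hom T Y),
    conflation t u /\ stable_retract X T.
Proof.
move=> c; have [g [m [eg em]]] := projective_map (idm Z) (projP Z) (confP Z) c.
rewrite compIm in eg.
have [T [t [u [s [r [c1 rs _ _]]]]]] := conflation_rotate c (confP Z) (projP Z) eg em.
by exists T, t, u; split=> //; apply: retract_stable_retract rs.
Qed.

(** The same triangle rotated twice: the kernel of [P_Y -> Y -> Z] is a syzygy of
    [Z], and an extension of [X] by [Omega Y]. *)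
Lemma conflation_rotate2 (X Y Z : E) (i : hom X Y) (p : hom Y Z) :
  conflation i p ->
  exists (K : E) (f : hom K (pres_proj (pres Y))) (t : hom (Omega Y) K)
      (u : hom K X),
    [/\ conflation f (p ∘ epi Y), conflation t u, f ∘ t = inc Y
      & i ∘ u = epi Y ∘ f].
Proof.
move=> c; have ki := exact_kernel hE c.
have [K [f [t [u [pb c1 ft]]]]] := conflation_pullback hE i (confP Y).
exists K, f, t, u; split=> //; last by rewrite pb.1.
have [||W [j cj]] := exact_comp_epi hE (p := epi Y) (q := p).
- by exists (Omega Y), (inc Y); exact: (confP Y).
- by exists X, i.
apply: conflation_kernel cj _ => //; split.
  by rewrite -compA pb.1 compA (conflation_comp0 c) comp0l.
move=> T g; rewrite -compA => /(kernel_lift ki) [h eh].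
have [w [w1 w2]] := pullback_map (u := g) (v := h) pb (esym eh).
exists w; split=> // w' ew'; apply: (pullback_eq pb); first by rewrite w1 ew'.
by apply: (kernel_mono ki); rewrite !compA -pb.1 -!compA w1 ew'.
Qed.

(** Exactness of [Ext(Z, B) -> Ext(Y, B) -> Ext(X, B)].  In degree one, a map on
    [Omega Y] is extended first to the kernel [K] of [conflation_rotate2] and
    then to [P_Y]; rotating the triangle three times lowers the degree. *)
Lemma ext_middle n (X Y Z B : E) (i : hom X Y) (p : hom Y Z) :
  conflation i p -> ext n X B -> ext n Z B -> ext n Y B.
Proof.
elim: n X Y Z i p => [|n IH] X Y Z i p c hX hZ.
  move=> f; have [K [j [t [u [c1 c2 e _]]]]] := conflation_rotate2 c.
  have [g eg] := ext0_extend f c2 hX; have [h eh] := ext0_extend g c1 hZ.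
  by exists h; rewrite -e compA eh eg.
have [K [j [t [u [c1 c2 _ _]]]]] := conflation_rotate2 c.
have [T [t' [u' [c3 h1]]]] := conflation_rotate_syzygy c2.
have [_ h2] := syzygy_stable_retract c1 (projP Y).
apply: (ext_retract h1); apply: (IH _ _ _ _ _ c3) => //.
have [h3 _] := syzygy_stable_retract c1 (projP Y).
exact: ext_retract h3 hZ.
Qed.

(** Exactness of [Ext^(n+1)(X, B) -> Ext^(n+2)(Z, B) -> Ext^(n+2)(Y, B)], which
    is [ext_middle] for the rotated conflation [Omega Y -> Omega Z -> X]. *)
Lemma ext_right n (X Y Z B : E) (i : hom X Y) (p : hom Y Z) :
  conflation i p -> ext n X B -> ext n.+1 Y B -> ext n.+1 Z B.
Proof.
move=> c hX hY; have [K [j [t [u [c1 c2 _ _]]]]] := conflation_rotate2 c.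
have [_ h] := syzygy_stable_retract c1 (projP Y).
exact: ext_retract h (ext_middle c2 hY hX).
Qed.

(** The case of [ext_right] that starts at [Hom(X, B)]. *)
Lemma ext_right0 (X Y Z B : E) (i : hom X Y) (p : hom Y Z) :
  conflation i p -> (forall f : hom X B, exists g, g ∘ i = f) ->
  ext 0 Y B -> ext 0 Z B.
Proof.
move=> c hX hY; have [K [j [t [u [c1 c2 e1 e2]]]]] := conflation_rotate2 c.
apply: (ext0_presentation c1 (projP Y)) => f.
have [h eh] := hY (f ∘ t).
have [|e ee] := cokernel_lift (exact_cokernel hE c2) (f := f - h ∘ j).
  by rewrite compBl -compA e1 eh subrr.
have [g eg] := hX e; exists (g ∘ epi Y + h).
by rewrite compDl -compA -e2 compA eg ee subrK.
Qed.

(** Exactness of [Ext(X, B) -> Ext(X, L) -> Ext(X, A)], the last one in the next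
    degree. *)
Lemma ext_second n (X A B L : E) (i : hom A B) (p : hom B L) :
  conflation i p -> ext n X B -> ext n.+1 X A -> ext n X L.
Proof.
elim: n X => [|n IH] X c; last exact: IH.
move=> hB hA f; have c1 := confP (Omega X); have k1 := exact_cokernel hE c1.
have [b [k [eb ek]]] := projective_map f (projP (Omega X)) c1 c.
have [g eg] := hA k.
have [|f' ef] := cokernel_lift k1 (f := b - i ∘ g).
  by rewrite compBl -compA eg ek subrr.
have [h eh] := hB f'; exists (p ∘ h); rewrite -compA eh.
apply: (cokernel_epi k1).
by rewrite -compA ef compBr eb compA (conflation_comp0 c) comp0l subr0.
Qed.

Lemma projective_retract (P Q : E) (s : hom P Q) (r : hom Q P) :
  r ∘ s = idm P -> projective Q -> projective P.
Proof.
move=> e pQ X Y p f hp; have [g eg] := pQ X Y p (f ∘ r) hp.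
by exists (g ∘ s); rewrite compA eg -compA e compmI.
Qed.

Lemma ext_projective n (P B : E) : projective P -> ext n P B.
Proof.
elim: n P => [|n IH] P pP; have [s es] := projective_lift (idm P) pP (confP P);
  have [r [er _]] := conflation_retraction (confP P) es.
  by move=> f; exists (f ∘ r); rewrite -compA er compmI.
by apply: IH; apply: projective_retract er (projP P).
Qed.

(** Applied to projective [P], [P'] and [Q], this says that [Omega] is faithful on
    stable maps out of [X] when [Ext^1(X, -)] vanishes on projectives: extending
    [u] to [P] gives a homotopy from [b] to a map that kills [K]. *)
Lemma syzygy_faithful (K P X K' P' X' Q : E) (i : hom K P) (p : hom P X)
    (j : hom K' P') (q : hom P' X') (a : hom X X') (b : hom P P')
    (u : hom K Q) (v : hom Q K') :
  conflation i p -> conflation j q -> ext 0 X Q ->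
  q ∘ b = a ∘ p -> j ∘ (v ∘ u) = b ∘ i -> exists g, q ∘ g = a.
Proof.
move=> c c' h e1 e2; have [u' eu] := ext0_extend u c h.
have kp := exact_cokernel hE c.
have [|g eg] := cokernel_lift kp (f := b - j ∘ v ∘ u').
  by rewrite compBl -e2 -!compA eu subrr.
exists g; apply: (cokernel_epi kp).
by rewrite -compA eg compBr e1 !compA (conflation_comp0 c') !comp0l subr0.
Qed.

(** The conflation [X -> X (+) Y -> Y], obtained as the pushout of the conflation
    [0 -> Y -> Y] along zero. *)
Lemma conflation_sum (X Y : E) : exists (S : E) (i : hom X S) (p : hom S Y)
  (s : hom Y S), conflation i p /\ p ∘ s = idm Y.
Proof.
have [K [j c]] := exact_id_epi hE Y.
have [S [s [i [p [_ c' e]]]]] := conflation_pushout hE (0 : hom K X) c.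
by exists S, i, p, s.
Qed.

End ExtTheory.

(** * Gorenstein projective objects *)

Section GorensteinProjective.
Variables (E : conflation_category) (hE : is_exact E).
Variable pres : forall X : E, projective_presentation X.

Local Notation Omega := (syzygy pres).
Local Notation inc X := (pres_inc (pres X)).
Local Notation epi X := (pres_epi (pres X)).
Local Notation projP X := (@pres_projective _ _ (pres X)).
Local Notation confP X := (pres_conflation (pres X)).
Local Notation ext := (ext_vanish pres).
Local Notation gproj := (@gorenstein_projective E).

Definition proj_perp (X : E) : Prop :=
  forall n (Q : E), projective Q -> ext n X Q.

(** A coinductive description of Gorenstein projectives: they form the largest
    coresolving class ([coresolving_gproj], [gproj_coresolving]).  It avoids the
    handling of two-sided complexes in all closure properties. *)
Definition coresolving (V : E -> Prop) : Prop :=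
  forall Y, V Y -> proj_perp Y /\
    exists (P Y' : E) (i : hom Y P) (p : hom P Y'),
      [/\ projective P, conflation i p & V Y'].

(** The right half of a complete resolution is chosen step by step inside [V],
    the left half is the projective resolution of [X].  It is totally acyclic
    because all its cycles have no Ext to projectives. *)
Lemma coresolving_gproj V X : coresolving V -> V X -> gproj X.
Proof.
move=> hV VX.
pose cid T (P : T -> Prop) := @constructive_indefinite_description T P.
have step (Y : {Y | V Y}) : exists (Y' : {Y | V Y}) (P : E)
    (i : hom (sval Y) P) (p : hom P (sval Y')), projective P /\ conflation i p.
  case: Y => Y VY; have [_ [P [Y' [i [p [pP c VY']]]]]] := hV _ VY.
  by exists (exist _ Y' VY'), P, i, p.
pose next Y := sval (cid _ _ (step Y)).
pose Z (j : int) : E := match j with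
  | Posz n => sval (iter n next (exist _ X VX))
  | Negz n => iter n.+1 Omega X end.
have perpZ j : proj_perp (Z j).
  case: j => n; first exact: (hV _ (svalP (iter n next _))).1.
  rewrite /Z; elim: {n}n.+1 => [|n IH]; first exact: (hV _ VX).1.
  by move=> m Q pQ; apply: (IH m.+1).
have conf j : exists (P : E) (k : hom (Z j) P) (q : hom P (Z (j + 1))),
    projective P /\ conflation k q.
  case: j => [n|[|n]].
  - rewrite (_ : Posz n + 1 = Posz n.+1); last by lia.
    have [P [i [p h]]] := svalP (cid _ _ (step (iter n next (exist _ X VX)))).
    by exists P, i, p.
  - rewrite (_ : Negz 0 + 1 = Posz 0); last by lia.
    by exists (pres_proj (pres X)), (inc X), (epi X); split; [exact: (projP X) | exact: (confP X)].
  rewrite (_ : Negz n.+1 + 1 = Negz n); last by lia.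
  pose Y := iter n.+1 Omega X.
  by exists (pres_proj (pres Y)), (inc Y), (epi Y); split; [exact: (projP Y) | exact: (confP Y)].
pose P j := sval (cid _ _ (conf j)).
have conf1 j : exists (k : hom (Z j) (P j)) (q : hom (P j) (Z (j + 1))),
    projective (P j) /\ conflation k q by exact: svalP (cid _ _ (conf j)).
pose k j := sval (cid _ _ (conf1 j)).
have conf2 j : exists q : hom (P j) (Z (j + 1)),
    projective (P j) /\ conflation (k j) q by exact: svalP (cid _ _ (conf1 j)).
pose q j := sval (cid _ _ (conf2 j)).
have kq j : projective (P j) /\ conflation (k j) (q j).
  exact: svalP (cid _ _ (conf2 j)).
exists P, (fun j => k (j + 1) ∘ q j), (k 0); split; first split.
- by move=> j; case: (kq j).
- by exists Z, k, q => j; split=> //; case: (kq j).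
- move=> Q pQ j f; rewrite compA => fd.
  have {}fd : f ∘ k (j + 1) = 0.
    by apply: (cokernel_epi (exact_cokernel hE (kq j).2)); rewrite comp0l.
  have [g eg] := cokernel_lift (exact_cokernel hE (kq (j + 1)).2) fd.
  have [h eh] := ext0_extend hE g (kq (j + 1 + 1)).2 (perpZ _ 0%N Q pQ).
  by exists h; rewrite compA eh eg.
have k0 := exact_kernel hE (kq 0).2; have k1 := exact_kernel hE (kq (0 + 1)).2.
split; first by rewrite -compA k0.1 comp0r.
move=> T f; rewrite -compA => df.
by apply: k0.2; apply: (kernel_mono k1); rewrite df comp0r.
Qed.

(** The total acyclicity at [P^(j+1)] is the vanishing of [Ext^1(Z^(j+3), Q)];
    higher degrees follow by going left along the cycles. *)
Lemma gproj_coresolving : coresolving gproj.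
Proof.
move=> G [P [d [k0 [[pP [Z [k [q hZ]]] tot] ker]]]].
(* The summands 1 are kept apart so that the types of the differentials match
   without casts; [subrK] reaches an arbitrary index. *)
have ext3 n j Q : projective Q -> ext n (Z (j + 1 + 1 + 1)) Q.
  move=> pQ; elim: n j => [|n IH] j.
    apply: (ext0_presentation hE (hZ (j + 1 + 1)).1 (pP _)) => f.
    have k1 := exact_cokernel hE (hZ (j + 1)).1.
    have [|g eg] := tot Q pQ j (f ∘ q (j + 1)).
      by rewrite (hZ j).2 compA -[_ ∘ k _]compA k1.1 comp0r comp0l.
    exists g; apply: (cokernel_epi k1).
    by rewrite eg (hZ (j + 1)).2 compA.
  have [_ h] := syzygy_stable_retract hE pres (hZ (j + 1 + 1)).1 (pP _).
  by apply: (ext_retract hE h); rewrite -[j](subrK 1); apply: IH.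
have perpZ j : proj_perp (Z j).
  move=> n Q; rewrite -[j](subrK 1) -[j - 1](subrK 1) -[j - 1 - 1](subrK 1).
  exact: ext3.
have gZ j : gproj (Z j).
  apply: (@coresolving_gproj (fun Y => exists j, Y = Z j)); last by exists j.
  move=> _ [{}j ->]; split=> //.
  by exists (P j), (Z (j + 1)), (k j), (q j); split; [| case: (hZ j) | exists (j + 1)].
have [c0 e0] := hZ 0; have [c1 _] := hZ (0 + 1); have kk := exact_kernel hE c1.
have c : conflation k0 (q 0).
  apply: conflation_kernel c0 _ => //; split.
    by apply: (kernel_mono kk); rewrite compA -e0 comp0r ker.1.
  by move=> T f qf; apply: ker.2; rewrite e0 -compA qf comp0r.
split; last by exists (P 0), (Z (0 + 1)), k0, (q 0).
move=> n Q pQ; have [h _] := syzygy_stable_retract hE pres c (pP 0).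
exact: (ext_retract hE h (perpZ (0 + 1) n.+1 Q pQ)).
Qed.

Lemma gproj_perp G : gproj G -> proj_perp G.
Proof. by move=> /gproj_coresolving []. Qed.

(** A syzygy of [G] is coresolved by [G] itself. *)
Lemma gproj_syzygy G : gproj G -> gproj (Omega G).
Proof.
move=> hG; apply: (@coresolving_gproj
  (fun Y => gproj Y \/ exists X, gproj X /\ Y = Omega X)); last by right; exists G.
move=> Y [/gproj_coresolving [h [P [Y' [i [p [pP c hY]]]]]] | [X [hX ->]]].
  by split=> //; exists P, Y', i, p; split=> //; left.
split; first by move=> n Q; apply: (gproj_perp hX n.+1).
exists (pres_proj (pres X)), X, (inc X), (epi X).
by split; [exact: (projP X) | exact: (confP X) | left].
Qed.

Lemma gproj_projective P : projective P -> gproj P.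
Proof.
move=> pP; apply: (@coresolving_gproj (@projective E)) pP => {}P pP.
split; first by move=> n Q _; apply: ext_projective.
have [Z [c cc]] := exact_id_mono hE P; have k := exact_cokernel hE cc.
have c0 : c = 0 by have := k.1; rewrite compmI.
exists P, Z, (idm P), c; split=> // X Y p f _; exists 0.
by apply: (cokernel_epi k); rewrite c0 !comp0r.
Qed.

(** The horseshoe construction to the right: with [X -> P] extended over [Y], the
    pushout of [Y] is [P (+) Z], and [Z -> Q] embeds it into [P (+) Q]. *)
Lemma coresolution_extension (X Y Z P X' Q Z' : E) (i : hom X Y) (p : hom Y Z)
    (a : hom X P) (b : hom P X') (a' : hom Z Q) (b' : hom Q Z') :
  conflation i p -> conflation a b -> conflation a' b' ->
  projective P -> projective Q -> ext 0 Z P ->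
  exists (S Y' : E) (j : hom Y S) (q : hom S Y') (i' : hom X' Y')
      (p' : hom Y' Z'),
    [/\ projective S, conflation j q & conflation i' p'].
Proof.
move=> c ca ca' pP pQ hZ; have kp := exact_cokernel hE c.
have [e ee] := ext0_extend hE a c hZ.
have [Y1 [f [y [y' [po cy yf]]]]] := conflation_pushout hE i ca.
have [|r [rf ry]] := pushout_map (u := idm P) (v := e) po; first by rewrite compIm ee.
have [|m [mf my]] := pushout_map (u := 0) (v := p) po; first by rewrite comp0l (conflation_comp0 hE c).
have [|s es] := cokernel_lift kp (f := y - f ∘ e).
  by rewrite compBl -compA ee po.1 subrr.
have ms : m ∘ s = idm Z.
  apply: (cokernel_epi kp).
  by rewrite -compA es compBr compA mf comp0l subr0 my compIm.
have rs : r ∘ s = 0.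
  apply: (cokernel_epi kp).
  by rewrite -compA es compBr compA rf compIm ry subrr comp0l.
have dec : f ∘ r + s ∘ m = idm Y1.
  apply: (pushout_eq po); rewrite compDl -!compA.
    by rewrite rf mf comp0r addr0 compmI compIm.
  by rewrite ry my es compIm addrC subrK.
have [S [g [z [z' [po2 cz _]]]]] := conflation_pushout hE s ca'.
have [Y' [q [i' [p' [po3 c3 _]]]]] := conflation_pushout hE y' cz.
have ky' := exact_cokernel hE cy.
exists S, Y', (z ∘ y), q, i', p'; split=> //.
  (* A map out of [S] is a compatible pair of maps out of [Q] and [Y1], and [Y1]
     is the direct sum of [P] and [Z]: liftings on [Q] and [P] suffice. *)
  move=> A B w h hw.
  have [al eal] := pQ _ _ w (h ∘ g) hw.
  have [be ebe] := pP _ _ w (h ∘ z ∘ f) hw.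
  have [|l [l1 l2]] := pushout_map (u := al) (v := be ∘ r + al ∘ a' ∘ m) po2.
    by rewrite compDl -!compA rs ms comp0r add0r compmI.
  exists l; apply: (pushout_eq po2); first by rewrite -compA l1 eal.
  rewrite -compA l2 compDr !compA ebe eal -[h ∘ g ∘ a']compA po2.1.
  by rewrite !compA -!(compA (h ∘ z)) -compDr dec compmI.
have [||W [w cw]] := exact_comp_mono hE (i := y) (j := z).
- by exists X', y'.
- by exists Z', z'.
apply: (conflation_cokernel hE cw); split.
  by rewrite compA po3.1 -compA ky'.1 comp0r.
move=> T h; rewrite compA => /(cokernel_lift ky') [n en].
have [l [l1 l2]] := pushout_map po3 (esym en).
exists l; split=> // l' el'; apply: (pushout_eq po3); first by rewrite l1 el'.
by apply: (cokernel_epi ky'); rewrite -!compA -po3.1 !compA l1 el'.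
Qed.

Lemma gproj_extension (X Y Z : E) (i : hom X Y) (p : hom Y Z) :
  conflation i p -> gproj X -> gproj Z -> gproj Y.
Proof.
move=> c hX hZ; apply: (@coresolving_gproj (fun Y => exists (X Z : E)
  (i : hom X Y) (p : hom Y Z), [/\ conflation i p, gproj X & gproj Z])); last first.
  by exists X, Z, i, p.
move=> {i p c hX hZ} {}Y [{}X [{}Z [i [p [c hX hZ]]]]].
have [perpX [P [X' [a [b [pP ca hX']]]]]] := gproj_coresolving hX.
have [perpZ [Q [Z' [a' [b' [pQ ca' hZ']]]]]] := gproj_coresolving hZ.
split.
  by move=> n R pR; apply: (ext_middle hE c); [apply: perpX | apply: perpZ].
have [S [Y' [j [q [i' [p' [pS cj c']]]]]]] :=
  coresolution_extension c ca ca' pP pQ (perpZ 0%N P pP).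
by exists S, Y', j, q; split=> //; exists X', Z', i', p'.
Qed.

Lemma GP_conflations_push : conflations_push (GP E).
Proof.
split.
- move=> X Y Z i p /(exact_kernel hE) [pi h]; split=> // T f; exact: h.
- move=> X Y Z i p /(exact_cokernel hE) [pi h]; split=> // T f; exact: h.
move=> X Y Z X' i p f c.
have [Y' [f' [i' [p' [po c' e]]]]] := conflation_pushout hE (f : hom (sval X) (sval X')) c.
exists (exist _ Y' (gproj_extension c' (svalP X') (svalP Z))), f', i', p'.
split=> //; split; first exact: po.1.
by move=> T u v; apply: po.2.
Qed.

Lemma GP_projective (P : GP E) : projective (sval P) -> projective P.
Proof.
by move=> pP X Y p f [K [i c]]; apply: pP; exists (sval K), i.
Qed.

Definition GP_pres (G : GP E) : projective_presentation G :=
  let P : GP E :=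
    exist _ (pres_proj (pres (sval G))) (gproj_projective (projP (sval G))) in
  @ProjectivePresentation (GP E) G
    (exist _ (Omega (sval G)) (gproj_syzygy (svalP G))) P
    (inc (sval G)) (epi (sval G)) (@GP_projective P (projP (sval G)))
    (confP (sval G)).

Lemma GP_ext_vanish n (A B : GP E) :
  ext_vanish GP_pres n A B <-> ext n (sval A) (sval B).
Proof. by elim: n A => [|n IH] A //=; apply: IH. Qed.

Lemma GP_Ext_eq0 n (A B : GP E) : Ext_eq0 n.+1 A B <-> ext n (sval A) (sval B).
Proof. by rewrite (Ext_eq0P GP_conflations_push GP_pres) GP_ext_vanish. Qed.

End GorensteinProjective.

(** * Covers by Gorenstein projective objects *)

Section Covers.
Variables (E : conflation_category) (hE : is_exact E).
Variable pres : forall X : E, projective_presentation X.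

Local Notation Omega := (syzygy pres).
Local Notation inc X := (pres_inc (pres X)).
Local Notation epi X := (pres_epi (pres X)).
Local Notation projP X := (@pres_projective _ _ (pres X)).
Local Notation confP X := (pres_conflation (pres X)).
Local Notation ext := (ext_vanish pres).
Local Notation syz := (syz pres).
Local Notation gproj := (@gorenstein_projective E).

Lemma syz_add m n X : syz (m + n) X = syz n (syz m X).
Proof. by elim: m X => [|m IH] X //=; apply: IH. Qed.

Lemma syz_iter n X : syz n X = iter n Omega X.
Proof. by elim: n X => [|n IH] X //; rewrite iterSr -IH. Qed.

Lemma ext_syz m n X Y : ext n (syz m X) Y <-> ext (m + n) X Y.
Proof. by elim: m X => [|m IH] X //=; apply: IH. Qed.

(** For Gorenstein projective [H]: a right approximation of [X] by Gorenstein
    projectives in the stable category. *)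
Definition stable_cover (H X : E) (h : hom H X) : Prop :=
  forall (G : E) (f : hom G X), gproj G -> exists g, stable_eq f (h ∘ g).

(** [G'] is an [Omega^(-n) G], computed in the Gorenstein projectives.  It is a
    relation because cosyzygies are not chosen. *)
Fixpoint cosyzygy (n : nat) (G G' : E) : Prop :=
  match n with
  | 0 => G = G'
  | m.+1 => exists (G1 P : E) (i : hom G1 P) (p : hom P G'),
      [/\ cosyzygy m G G1, projective P, conflation i p & gproj G']
  end.

(** [Omega] is faithful on stable maps out of the Gorenstein projective
    [Omega^(n+1) G], and these maps compute Ext. *)
Lemma ext_syzygy_both n G Y : gproj G -> ext n (Omega G) (Omega Y) -> ext n G Y.
Proof.
elim: n G => [|n IH] G hG; last by apply: IH; apply: gproj_syzygy.
move=> h f.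
have [b [k [eb ek]]] := projective_map hE f (projP _) (confP (Omega G)) (confP Y).
have [g eg] := h k; rewrite -eg in ek.
have h1 : ext 0 (Omega G) (pres_proj (pres (Omega G))).
  exact: (gproj_perp hE pres hG 1%N (projP _)).
have [g' eg'] := syzygy_faithful hE (confP (Omega G)) (confP Y) h1 eb ek.
have [l el] := gproj_perp hE pres hG 0%N (projP Y) g'.
by exists (epi Y ∘ l); rewrite -compA el.
Qed.

(** [Omega^(-n)] is left adjoint to [Omega^n] on stable maps out of Gorenstein
    projectives; only the part that concerns the vanishing of Ext is recorded. *)
Lemma cosyzygy_ext n m G G' Y :
  cosyzygy n G G' -> ext m G (syz n Y) -> ext m G' Y.
Proof.
elim: n G' Y => [|n IH] G' Y; first by move=> <-.
move=> [G1 [P [i [p [hc pP c hG']]]]] /(IH _ _ hc) h.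
apply: ext_syzygy_both => //; apply: (ext_retract hE) h.
by have [] := syzygy_stable_retract hE pres c pP.
Qed.

(** [h] is induced on cokernels by an extension of [h1] to the projectives.  For
    [f : G -> X], a factorization of [Omega f] through [h1] induces [g : G -> G'],
    and [f - h g] vanishes stably because its syzygy does. *)
Lemma stable_cover_cosyzygy X G1 P G' (i : hom G1 P) (p : hom P G')
    (h1 : hom G1 (Omega X)) :
  conflation i p -> projective P -> gproj G' -> stable_cover h1 ->
  exists h : hom G' X, stable_cover h.
Proof.
move=> c pP hG' h1c; have perp := gproj_perp hE pres.
have [b eb] := ext0_extend hE (inc X ∘ h1) c (perp _ hG' 0%N _ (projP X)).
have [|h eh] := cokernel_lift (exact_cokernel hE c) (f := epi X ∘ b).
  by rewrite -compA eb compA (conflation_comp0 hE (confP X)) comp0l.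
exists h => G f hG.
have [bf [k [ebf ek]]] := projective_map hE f (projP G) (confP G) (confP X).
have [g1 [Q [u [v [pQ vu]]]]] := h1c _ k (gproj_syzygy hE pres hG).
have [b1 eb1] := ext0_extend hE (i ∘ g1) (confP G) (perp _ hG 0%N _ pP).
have kG := exact_cokernel hE (confP G).
have [|g eg] := cokernel_lift kG (f := p ∘ b1).
  by rewrite -compA eb1 compA (conflation_comp0 hE c) comp0l.
have [||g' eg'] := syzygy_faithful hE (a := f - h ∘ g) (b := bf - b ∘ b1)
  (u := u) (v := v) (confP G) (confP X) (perp _ hG 0%N _ pQ).
- by rewrite compBr compBl ebf -compA eg !compA eh.
- by rewrite vu compBr compBl ek -!compA eb1 !compA eb.
exists g, (pres_proj (pres X)), g', (epi X); split=> //; exact: (projP X).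
Qed.

Lemma stable_cover_cosyzygies n X G (h : hom G (syz n X)) :
  gproj G -> stable_cover h ->
  exists G' (h' : hom G' X), [/\ cosyzygy n G G', gproj G' & stable_cover h'].
Proof.
elim: n X h => [|n IH] X h hG hh; first by exists G, h.
have [G1 [h1 [c1 hG1 hc1]]] := IH _ h hG hh.
have [_ [P [G' [i [p [pP c hG']]]]]] := gproj_coresolving hE pres hG1.
have [h' hc'] := stable_cover_cosyzygy c pP hG' hc1.
by exists G', h'; split=> //; exists G1, P, i, p.
Qed.

Lemma stable_retract_cover X B : stable_retract X B ->
  exists h : hom B X, stable_cover h.
Proof.
move=> [s [r [Q [u [v [pQ vu]]]]]]; exists r => G f _.
exists (s ∘ f), Q, (u ∘ f), (- v); split=> //.
by rewrite compNl compA vu compBl compIm opprB compA.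
Qed.

Lemma ext_stable_cover n A H X (h : hom H X) :
  gproj A -> stable_cover h -> ext n A H -> ext n A X.
Proof.
move=> hA hh; elim: n A hA => [|n IH] A hA; last first.
  by apply: IH; apply: gproj_syzygy.
move=> hAH f; have [g [Q [u [v [pQ vu]]]]] := hh _ f (gproj_syzygy hE pres hA).
have [g' eg] := hAH g; have [u' eu] := gproj_perp hE pres hA 0%N pQ u.
exists (v ∘ u' + h ∘ g').
by rewrite compDl -!compA eg eu vu subrK.
Qed.

Lemma stable_gproj_syz n X :
  (exists B, [/\ gproj B, stable_retract X B & stable_retract B X]) ->
  exists B, [/\ gproj B, stable_retract (syz n X) B & stable_retract B (syz n X)].
Proof.
elim: n X => [|n IH] X // [B [hB h1 h2]]; apply: IH; exists (Omega B); split.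
- exact: gproj_syzygy.
- exact: (stable_retract_syzygy hE) (confP _) (projP _) (confP _) (projP _) h1.
exact: (stable_retract_syzygy hE) (confP _) (projP _) (confP _) (projP _) h2.
Qed.

End Covers.

(** * Cluster tilting *)

Section ClusterTilting.
Variables (E : conflation_category) (hE : is_exact E).
Variable pres : forall X : E, projective_presentation X.
Hypothesis hdim : forall X : E, GP_dim_finite pres X.
Variables (d : nat) (hd : (0 < d)%N).
Variables (M : E -> Prop) (hM : dZ_cluster_tilting d M).

Local Notation Omega := (syzygy pres).
Local Notation inc X := (pres_inc (pres X)).
Local Notation epi X := (pres_epi (pres X)).
Local Notation projP X := (@pres_projective _ _ (pres X)).
Local Notation confP X := (pres_conflation (pres X)).
Local Notation ext := (ext_vanish pres).
Local Notation syz := (syz pres).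
Local Notation gproj := (@gorenstein_projective E).

Let hC := exact_conflations_push hE.

Lemma tilting_left A :
  M A <-> forall X, M X -> forall i, (i.+1 < d)%N -> ext i A X.
Proof.
rewrite (ct_left hM.1 A).
by split=> h X MX; apply/(Ext_eq0_range hC); apply: h.
Qed.

Lemma tilting_ext X Y i : M X -> M Y -> ~~ (d %| i.+1)%N -> ext i X Y.
Proof. by move=> MX MY hi; apply/(Ext_eq0P hC); apply: hM.2. Qed.

Lemma tilting_rigid X Y i : M X -> M Y -> (i.+1 < d)%N -> ext i X Y.
Proof. by move=> MX MY hi; apply: tilting_ext; rewrite // gtnNdvd. Qed.

Lemma tilting_projective P : projective P -> M P.
Proof. by move=> pP; apply/tilting_left => X _ i _; apply: ext_projective. Qed.

Lemma tilting_retract X Y : stable_retract X Y -> M Y -> M X.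
Proof.
move=> h MY; apply/tilting_left => Z MZ i hi.
exact: (ext_retract hE h (tilting_rigid MY MZ hi)).
Qed.

(** [Ext^i(Omega^d X, Y) = Ext^(i+d)(X, Y)] and [d] does not divide [i + d]. *)
Lemma tilting_syz X : M X -> M (syz d X).
Proof.
move=> MX; apply/tilting_left => Y MY i hi; apply/ext_syz.
by apply: tilting_ext => //; rewrite -addnS dvdn_addr // gtnNdvd.
Qed.

Lemma tilting_syz_mul m X : M X -> M (syz (m * d) X).
Proof.
elim: m X => [|m IH] X MX //; rewrite mulSn syz_add.
by apply: IH; apply: tilting_syz.
Qed.

(** [Ext^i(Omega^(-d) G, Y)] embeds into [Ext^i(G, Omega^d Y)], and [Omega^d Y]
    is again in [M]. *)
Lemma tilting_cosyzygy G G' : cosyzygy d G G' -> M G -> M G'.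
Proof.
move=> c MG; apply/tilting_left => Y MY i hi.
exact: (cosyzygy_ext hE c (tilting_rigid MG (tilting_syz MY) hi)).
Qed.

Lemma tilting_cover_lift m X G (h : hom G (syz (m * d) X)) :
  M X -> gproj G -> M G -> stable_cover h ->
  exists H (h' : hom H X), [/\ M H, gproj H & stable_cover h'].
Proof.
elim: m X h => [|m IH] X; first by move=> h *; exists G, h.
rewrite mulSn syz_add => h MX hG MG hh.
have [G1 [h1 [MG1 hG1 hc1]]] := IH _ h (tilting_syz MX) hG MG hh.
have [H [h' [c hH hc]]] := stable_cover_cosyzygies hE hG1 hc1.
by exists H, h'; split=> //; apply: tilting_cosyzygy c MG1.
Qed.

(** Finite Gorenstein projective dimension enters here: a high syzygy of [X] of
    order divisible by [d] is stably Gorenstein projective. *)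
Lemma tilting_stable_cover X : M X ->
  exists H (h : hom H X), [/\ M H, gproj H & stable_cover h].
Proof.
move=> MX; have [n [[B [hB /stable_iso_retract [h1 h2]]] _]] := hdim X.
rewrite -syz_iter in h1 h2.
have [|B' [hB' h3 h4]] :=
  @stable_gproj_syz _ hE pres (n * d - n) (syz n X); first by exists B.
rewrite -syz_add subnKC ?leq_pmulr // in h3 h4.
have [h hh] := stable_retract_cover h3.
apply: tilting_cover_lift hh => //.
exact: tilting_retract h4 (tilting_syz_mul n MX).
Qed.

(** Adding [P_X -> X] to a stable cover absorbs the maps that
    factor through projectives. *)
Lemma tilting_gproj_precover X : M X ->
  exists S (s : hom S X), [/\ M S, gproj S &
    forall (G : E) (f : hom G X), gproj G -> exists g, s ∘ g = f].
Proof.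
move=> MX; have [H [h [MH hH hh]]] := tilting_stable_cover MX.
have [S [i [p [j [c pj]]]]] := conflation_sum hE H (pres_proj (pres X)).
have [r [ri dec]] := conflation_retraction hE c pj.
have rj : r ∘ j = 0.
  apply: (kernel_mono (exact_kernel hE c)); rewrite comp0r.
  apply: (addIr (j ∘ p ∘ j)).
  by rewrite compA -compDl dec compIm add0r -compA pj compmI.
exists S, (h ∘ r + epi X ∘ p); split.
- apply: tilting_retract MH; exists r, i, (pres_proj (pres X)), p, (- j).
  split; first exact: (projP X).
  by rewrite -dec opprD addNKr compNl.
- exact: gproj_extension hE pres _ _ _ _ _ c hH (gproj_projective hE pres (projP X)).
move=> G f hG; have [g [Q [u [v [pQ vu]]]]] := hh _ f hG.
have [v' ev] := projective_lift v pQ (confP X).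
exists (i ∘ g + j ∘ v' ∘ u).
rewrite compDr !compDl -!compA [r ∘ (i ∘ g)]compA ri compIm.
rewrite [p ∘ (i ∘ g)]compA (conflation_comp0 hE c) comp0l comp0r addr0.
rewrite [r ∘ (j ∘ _)]compA rj comp0l comp0r add0r.
by rewrite [p ∘ (j ∘ _)]compA pj compIm compA ev vu addrC subrK.
Qed.

Lemma gproj_tilting_left A : gproj A ->
  (forall N, gproj N -> M N -> forall i, (i.+1 < d)%N -> ext i A N) -> M A.
Proof.
move=> hA h; apply/tilting_left => X MX i hi.
have [H [s [MH hH hs]]] := tilting_stable_cover MX.
by apply: (ext_stable_cover hE hA hs); apply: h.
Qed.

Lemma gproj_left_approximation A : gproj A ->
  exists S (s : hom A S), [/\ M S, gproj S &
    forall N (f : hom A N), M N -> exists g, g ∘ s = f].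
Proof.
move=> hA; have [_ [X [a [MX ha]]]] := ct_functorially_finite hM.1 A.
have [S [s [MS hS hs]]] := tilting_gproj_precover MX.
have [b eb] := hs _ a hA; exists S, b; split=> // N f MN.
by have [g eg] := ha _ f MN; exists (g ∘ s); rewrite -compA eb.
Qed.

(** With [A -> P] a coresolution step and [A -> S] an approximation, [T] is
    [S (+) P]: the projective makes the map an admissible monomorphism, with the
    pushout [Y] as cokernel, which is an extension of [A'] by [S]. *)
Lemma gproj_left_conflation A : gproj A ->
  exists T L (t : hom A T) (u : hom T L),
    [/\ conflation t u, M T, gproj T, gproj L &
      forall N (f : hom A N), M N -> exists g, g ∘ t = f].
Proof.
move=> hA; have [S [s [MS hS hs]]] := gproj_left_approximation hA.
have [_ [P [A' [a [b [pP c hA']]]]]] := gproj_coresolving hE pres hA.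
have [Y [g [i [p [po cp pg]]]]] := conflation_pushout hE s c.
have [T [t [u [x [r [c1 rx xr rt]]]]]] := conflation_rotate hE cp c pP pg (esym po.1).
have hY : gproj Y by apply: (gproj_extension hE pres cp hS hA').
exists T, Y, t, u; split=> //.
- by apply: tilting_retract MS; exists r, x.
- exact: (gproj_extension hE pres c1 hA hY).
move=> N f MN; have [e ee] := hs _ f MN; exists (- (e ∘ r)).
by rewrite compNl -compA rt compNr opprK.
Qed.

(** The object is replaced by the cokernel of its left approximation: each time
    one degree of orthogonality passes from the right to the left, until
    [gproj_tilting_left] applies.  On the way back the sequences split. *)
Lemma gproj_tilting_right k j A : (k + j.+1 = d)%N -> gproj A ->
  (forall N, gproj N -> M N -> forall i, (i.+1 + j < d)%N -> ext i N A) ->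
  (forall N, gproj N -> M N -> forall i, (i < j)%N -> ext i A N) -> M A.
Proof.
elim: k j A => [|k IH] j A ed hA hr hl.
  by apply: gproj_tilting_left => // N hN MN i hi; apply: hl => //; lia.
have [T [L [t [u [c MT hT hL ha]]]]] := gproj_left_conflation hA.
have ML : M L.
  apply: (IH j.+1) => //; first by lia.
    move=> N hN MN i hi; apply: (ext_second hE c).
      by apply: tilting_rigid => //; lia.
    by apply: hr => //; lia.
  move=> N hN MN [_|i hi].
    apply: (ext_right0 hE c); first by move=> f; apply: ha.
    by apply: tilting_rigid => //; lia.
  apply: (ext_right hE c); first by apply: hl.
  by apply: tilting_rigid => //; lia.
have [|s es] := ext0_section hE c (pres := pres); first by apply: hr => //; lia.
have [r [rt _]] := conflation_retraction hE c es.
exact: tilting_retract (retract_stable_retract pres rt) MT.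
Qed.

Lemma gproj_cluster_tilting : cluster_tilting d (restrict_to_GP M).
Proof.
have GPE := GP_Ext_eq0 hE pres.
have rigid (X Y : GP E) i : restrict_to_GP M X -> restrict_to_GP M Y ->
    (0 < i < d)%N -> Ext_eq0 i X Y.
  by case: i => // i MX MY hi; apply/GPE; apply: tilting_rigid.
split.
- move=> A; have hA := svalP A; split.
    have [[X [a [MX ha]]] _] := ct_functorially_finite hM.1 (sval A).
    have [S [s [MS hS hs]]] := tilting_gproj_precover MX.
    exists (exist _ S hS), (a ∘ s); split=> // N f MN.
    have [g eg] := ha _ f MN; have [g' eg'] := hs _ g (svalP N).
    by exists g'; rewrite -eg -eg' /= compA.
  have [S [s [MS hS hs]]] := gproj_left_approximation hA.
  by exists (exist _ S hS), s; split=> // N f; apply: hs.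
- move=> A; split; first by move=> MA X MX i; apply: rigid.
  move=> h; apply: (gproj_tilting_left (svalP A)) => N hN MN i hi.
  by apply/(GPE _ A (exist _ N hN)); apply: h.
- move=> A; split; first by move=> MA X MX i; apply: rigid.
  move=> h; apply: (@gproj_tilting_right d.-1 0) (svalP A) _ _ => //; first by lia.
  move=> N hN MN i hi; apply/(GPE _ (exist _ N hN) A); apply: h => //.
  by rewrite -[i.+1]addn0.
- move=> A; have [_ [P [A' [i [p [pP c hA']]]]]] := gproj_coresolving hE pres (svalP A).
  exists (exist _ P (gproj_projective hE pres pP)), i; split.
    exact: tilting_projective.
  by exists (exist _ A' hA'), p.
move=> A; exists (pres_proj (GP_pres hE pres A)), (epi (sval A)); split.
  exact: tilting_projective (projP (sval A)).
by exists (exist _ _ (gproj_syzygy hE pres (svalP A))), (inc (sval A)); apply: (confP (sval A)).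
Qed.

End ClusterTilting.

Theorem theorem7p3 (d : nat) (hd : (0 < d)%N)
  (E : conflation_category) (hE : is_exact E) (hP : enough_projectives E)
  (pres : forall X : E, projective_presentation X)
  (hdim : forall X : E, GP_dim_finite pres X)
  (M : E -> Prop) (hM : dZ_cluster_tilting d M) :
  dZ_cluster_tilting d (restrict_to_GP M).
Proof.
split; first exact: (gproj_cluster_tilting hE hdim hd hM).
move=> X Y MX MY [|i]; first by rewrite dvdn0.
by move=> hi; apply/(GP_Ext_eq0 hE pres); apply: (tilting_ext hE pres hM MX MY hi).
Qed.
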